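(* Let $1\le k<n$ and let $$A=\begin{bmatrix}\widehat\Lambda & E^{T}\\ E & A_2\end{bmatrix}\in\mathbb{R}^{n\times n}$$ be a symmetric matrix, where $\widehat\Lambda=\mathrm{diag}(\theta_1,\ldots,\theta_k)\in\mathbb{R}^{k\times k}$, $E=[E_1,E_2,\ldots,E_k]\in\mathbb{R}^{(n-k)\times k}$ has columns $E_1,\dots,E_k$, and $A_2\in\mathbb{R}^{(n-k)\times(n-k)}$ is symmetric. Suppose that, for some $i\ge1$, $\ell\ge 1$ with $i+\ell-1\le k$, the $\ell$ values $\theta_i,\ldots,\theta_{i+\ell-1}$ all lie in the interval $[\lambda_0-\Delta,\lambda_0+\Delta]$, where $\lambda_0\in\mathbb{R}$ and $\Delta\ge0$. Define $\mathcal{I}=\{i,i+1,\ldots,i+\ell-1\}$ and $E_{\mathcal I}=[E_i,E_{i+1},\ldots,E_{i+\ell-1}]$. Suppose also that $$\delta_{\mathcal I}=\min_j|\lambda_0-\lambda_j(A_2)|-\Delta-\|E_{\mathcal I}\|_2>0,$$ $$\delta_{\mathcal I,j}=|\theta_j-\lambda_0|-\Delta-\|E_{\mathcal I}\|_2>0\quad\text{for all }1\le j\le k,\ j\notin\mathcal I,$$ and further that $$d_{\mathcal I}=\frac{1}{\delta_{\mathcal I}-\displaystyle\sum_{1\le j\le k,\ j\notin\mathcal I}\frac{\|E_j\|_2^2}{\delta_{\mathcal I,j}}}>0.$$ Then there exist $\ell$ eigenvalues $\lambda_i,\ldots,\lambda_{i+\ell-1}$ of $A$ (counted with multiplicity)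 satisfying $$|\lambda_{i+j}-\theta_{i+j}|\le d_{\mathcal I}\,\|E_{\mathcal I}\|_2^2,\qquad j=0,1,2,\ldots,\ell-1.$$ Moreover, for $t\in[0,1]$ let $A^{(\mathcal I)}(t)$ be the symmetric matrix obtained from $A$ by replacing the block of columns $E_{\mathcal I}$ of $E$ by $tE_{\mathcal I}$ (and correspondingly the rows $E_{\mathcal I}^T$ of $E^T$ by $tE_{\mathcal I}^T$), and for $j=0,1,\ldots,\ell-1$ let $x(t)\ne0$ (depending on $j$) and $\lambda_{i+j}(t)$ be continuous functions of $t\in[0,1]$ with $A^{(\mathcal I)}(t)x(t)=\lambda_{i+j}(t)x(t)$ and $\lambda_{i+j}(0)=\theta_{i+j}$. Then, with $\lambda_{i+j}=\lambda_{i+j}(1)$, the bound $|\lambda_{i+j}-\theta_{i+j}|\le d_{\mathcal I}\|E_{\mathcal I}\|_2^2$ ($j=0,\dots,\ell-1$) holds with the specific $\delta_{\mathcal I},\delta_{\mathcal I,j}$ above replaced by any numbers $\delta_{\mathcal I}$, $\delta_{\mathcal I,j}$ ($1\le j\le k$, $j\notin\mathcal I$) such that $$0<\delta_{\mathcal I}\le\min_{p\in\mathcal I,\ j}\ \min_{0\le t\le1}|\lambda_p(t)-\lambda_j(A_2)|,\qquad 0<\delta_{\mathcal I,j}\le\min_{p\in\mathcal I}\ \min_{0\le t\le1}|\lambda_p(t)-\theta_j|,$$ where $d_{\mathcal I}$ is given by the same formula in terms of these numbers and is assumed to satisfy $d_{\mathcal I}>0$.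
   Context: $\|\cdot\|_2$ denotes the spectral norm of a matrix, which is the Euclidean norm for a vector. $\lambda_j(A_2)$, $j=1,\dots,n-k$, are the eigenvalues of $A_2$. The $\theta_i$ are called Ritz values. *)

(* Defs.v *)
(* MathComp with MathComp-Analysis; the real numbers are an arbitrary realType. *)
From HB Require Import structures.
From mathcomp Require Import all_boot all_order all_algebra.
From mathcomp Require Import all_classical all_reals all_analysis.
Import Order.TTheory GRing.Theory Num.Theory.
Import numFieldNormedType.Exports.

Set Implicit Arguments.
Unset Strict Implicit.
Unset Printing Implicit Defensive.

Local Open Scope classical_set_scope.
Local Open Scope ring_scope.

Definition enorm (R : realType) (n : nat) (v : 'cV[R]_n) : R :=
  Num.sqrt (\sum_i v i 0 ^+ 2).

(* Taken over the unit ball, so that the set is nonempty even when n = 0. *)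
Definition norm2 (R : realType) (m n : nat) (M : 'M[R]_(m, n)) : R :=
  sup [set enorm (M *m x) | x in [set x : 'cV[R]_n | enorm x <= 1]].

Lemma norm2_cV (R : realType) (m : nat) (v : 'cV[R]_m) : norm2 v = enorm v.
Proof.
have E x : enorm (v *m x) = `|x 0 0| * enorm v.
  rewrite /enorm -sqrtr_sqr -sqrtrM ?sqr_ge0 //; congr Num.sqrt.
  rewrite mulr_sumr; apply: eq_bigr => i _.
  by rewrite mxE big_ord1 exprMn mulrC.
have E1 (x : 'cV[R]_1) : enorm x = `|x 0 0|.
  by rewrite /enorm big_ord1 sqrtr_sqr.
have v0 : 0 <= enorm v by exact: sqrtr_ge0.
have ub : ubound [set enorm (v *m x) | x in [set x : 'cV[R]_1 | enorm x <= 1]]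
    (enorm v).
  by move=> _ [x /= x1 <-]; rewrite E ler_piMl // -E1.
have mem : [set enorm (v *m x) | x in [set x : 'cV[R]_1 | enorm x <= 1]]
    (enorm v).
  by exists 1 => /=; rewrite ?E ?E1 mxE eqxx normr1 ?mul1r.
apply/eqP; rewrite eq_le; apply/andP; split.
  by apply: ge_sup => //; exists (enorm v).
by apply: ub_le_sup => //; exists (enorm v).
Qed.

(* [lam] lists all eigenvalues of [M], in an arbitrary order and repeated
   according to multiplicity. *)
Definition eigenvalues_of (R : realType) (n : nat) (M : 'M[R]_n)
    (lam : 'I_n -> R) : Prop :=
  char_poly M = \prod_(j < n) ('X - (lam j)%:P).

Definition ritz_mx (R : realType) (k m : nat) (theta : 'rV[R]_k)
    (E : 'M[R]_(m, k)) (A2 : 'M[R]_m) : 'M[R]_(k + m) :=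
  block_mx (diag_mx theta) E^T E A2.

(* Indices start at 0: the cluster occupies positions i, ..., i + l - 1 with
   i + l <= k. *)
Definition cluster_set (k i l : nat) : {set 'I_k} :=
  [set p : 'I_k | (i <= p < i + l)%N]%SET.

Definition cluster_idx (k i l : nat) (h : (i + l <= k)%N) (q : 'I_l) : 'I_k :=
  widen_ord h (rshift i q).

Definition cluster_cols (R : realType) (k m i l : nat) (h : (i + l <= k)%N)
    (E : 'M[R]_(m, k)) : 'M[R]_(m, l) :=
  colsub (cluster_idx h) E.

Definition scale_cluster (R : realType) (k m i l : nat) (t : R)
    (E : 'M[R]_(m, k)) : 'M[R]_(m, k) :=
  \matrix_(r, p) (if p \in cluster_set k i l then t * E r p else E r p).

Definition d_coef (R : realType) (k m i l : nat) (E : 'M[R]_(m, k))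
    (delta : R) (deltaJ : 'I_k -> R) : R :=
  (delta - \sum_(p | p \notin cluster_set k i l)
             norm2 (col p E) ^+ 2 / deltaJ p)^-1.

(* Main.v *)
Require Import Defs.
From mathcomp Require Import all_boot all_order all_fingroup all_algebra.
From mathcomp Require Import all_classical all_reals all_analysis.
From mathcomp Require Import ring lra complex.
Import Order.TTheory GRing.Theory Num.Theory.
Import numFieldNormedType.Exports.
Set Implicit Arguments.
Unset Strict Implicit.
Unset Printing Implicit Defensive.
Local Open Scope classical_set_scope.
Local Open Scope ring_scope.

(* Write I for the cluster, A(t) for A with E_I scaled by t, P for the
projection on the cluster coordinates, and let S(lam) be the Schur complement
A2 - lam - sum_{p notin I} E_p E_p^T / (theta_p - lam).  If lam is at distance
at least delta from the spectrum of A2 and deltaJ p from theta_p, p notin I,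
then |w| <= d |S(lam) w| for all w.

Second part: if A(t) x = lam x with x = (x1, x2), then S(lam) x2 = - t E P x1,
so |x2| <= d t |E_I| |x|.  As A(t) is affine in t and x is continuous, lam is
differentiable with lam' = 2 <E P x1, x2> / |x|^2, whence
|lam'| <= 2 t d |E_I|^2, and the mean value theorem concludes.

First part, without following eigenvalues in t: eliminating all coordinates
outside the cluster, A - lam is congruent to A(0) - lam up to the form
- <S(lam)^-1 E P x1, E P x1>, whose absolute value is at most eta |x|^2 after
the change of variables, with eta = d |E_I|^2.  A minimax argument then gives
|a_r - b_r| <= eta for the sorted eigenvalues a of A and b of A(0) whenever
b_r is one of the theta_p, p in I, provided that b_r + eta and b_r - eta are
within |E_I| of [lambda0 - Delta, lambda0 + Delta], which holds when
eta <= |E_I|.  Otherwise the same minimax argument for A - A(0) (Weyl's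
inequality) gives the better bound |E_I|. *)

(** * Euclidean inner product and norm *)

Definition dot (R : realType) (n : nat) (u v : 'cV[R]_n) : R :=
  (u^T *m v) 0 0.

Lemma dotE (R : realType) n (u v : 'cV[R]_n) : dot u v = \sum_i u i 0 * v i 0.
Proof. by rewrite /dot mxE; apply: eq_bigr => j _; rewrite mxE. Qed.

Lemma dotC (R : realType) n (u v : 'cV[R]_n) : dot u v = dot v u.
Proof. by rewrite !dotE; apply: eq_bigr => j _; rewrite mulrC. Qed.

Lemma dotDr (R : realType) n (u v w : 'cV[R]_n) :
  dot u (v + w) = dot u v + dot u w.
Proof. by rewrite /dot mulmxDr mxE. Qed.

Lemma dotDl (R : realType) n (u v w : 'cV[R]_n) :
  dot (u + v) w = dot u w + dot v w.
Proof. by rewrite dotC dotDr !(dotC w). Qed.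

Lemma dotZr (R : realType) n c (u v : 'cV[R]_n) : dot u (c *: v) = c * dot u v.
Proof. by rewrite /dot -scalemxAr mxE. Qed.

Lemma dotZl (R : realType) n c (u v : 'cV[R]_n) : dot (c *: u) v = c * dot u v.
Proof. by rewrite dotC dotZr dotC. Qed.

Lemma dotNr (R : realType) n (u v : 'cV[R]_n) : dot u (- v) = - dot u v.
Proof. by rewrite -scaleN1r dotZr mulN1r. Qed.

Lemma dotNl (R : realType) n (u v : 'cV[R]_n) : dot (- u) v = - dot u v.
Proof. by rewrite dotC dotNr dotC. Qed.

Lemma dot_mulmxl (R : realType) m n (A : 'M[R]_(m, n)) u v :
  dot (A *m u) v = dot u (A^T *m v).
Proof. by rewrite /dot trmx_mul mulmxA. Qed.

Lemma dot_col_mx (R : realType) m n (u1 v1 : 'cV[R]_m) (u2 v2 : 'cV[R]_n) :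
  dot (col_mx u1 u2) (col_mx v1 v2) = dot u1 v1 + dot u2 v2.
Proof. by rewrite /dot tr_col_mx mul_row_col mxE. Qed.

Lemma dotvv_sum (R : realType) n (v : 'cV[R]_n) : dot v v = \sum_i v i 0 ^+ 2.
Proof. by rewrite dotE; apply: eq_bigr => j _; rewrite expr2. Qed.

Lemma dot_ge0 (R : realType) n (v : 'cV[R]_n) : 0 <= dot v v.
Proof. by rewrite dotvv_sum sumr_ge0 // => j _; rewrite sqr_ge0. Qed.

Lemma dot_eq0 (R : realType) n (v : 'cV[R]_n) : (dot v v == 0) = (v == 0).
Proof.
apply/eqP/eqP => [|->]; last by rewrite /dot mulmx0 mxE.
rewrite dotvv_sum => /eqP; rewrite psumr_eq0 => [/allP v0|j _]; last exact: sqr_ge0.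
apply/matrixP => j c; rewrite ord1 mxE; apply/eqP.
by have := v0 j (mem_index_enum _); rewrite sqrf_eq0.
Qed.

Lemma enorm_ge0 (R : realType) n (v : 'cV[R]_n) : 0 <= enorm v.
Proof. exact: sqrtr_ge0. Qed.

Lemma enorm_sqr (R : realType) n (v : 'cV[R]_n) : enorm v ^+ 2 = dot v v.
Proof. by rewrite /enorm -dotvv_sum sqr_sqrtr ?dot_ge0. Qed.

Lemma enorm_eq0 (R : realType) n (v : 'cV[R]_n) : (enorm v == 0) = (v == 0).
Proof. by rewrite -dot_eq0 -enorm_sqr sqrf_eq0. Qed.

Lemma enorm0 (R : realType) n : enorm (0 : 'cV[R]_n) = 0.
Proof. by apply/eqP; rewrite enorm_eq0. Qed.

Lemma enorm_le (R : realType) m n (u : 'cV[R]_m) (v : 'cV[R]_n) :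
  (enorm u <= enorm v) = (dot u u <= dot v v).
Proof. by rewrite -!enorm_sqr ler_sqr ?nnegrE ?enorm_ge0. Qed.

Lemma enormZ (R : realType) n c (v : 'cV[R]_n) : enorm (c *: v) = `|c| * enorm v.
Proof.
apply/eqP; rewrite -(eqrXn2 (n := 2)) ?mulr_ge0 ?enorm_ge0 //.
by rewrite exprMn !enorm_sqr dotZl dotZr mulrA real_normK ?num_real // expr2.
Qed.

Lemma enormN (R : realType) n (v : 'cV[R]_n) : enorm (- v) = enorm v.
Proof. by rewrite -scaleN1r enormZ normrN1 mul1r. Qed.

Lemma cauchy_schwarz (R : realType) n (u v : 'cV[R]_n) :
  `|dot u v| <= enorm u * enorm v.
Proof.
rewrite -(ler_pXn2r (n := 2)) ?nnegrE ?mulr_ge0 ?enorm_ge0 //.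
rewrite exprMn !enorm_sqr real_normK ?num_real //.
have [->|v0] := eqVneq v 0; first by rewrite /dot !mulmx0 mxE mulr0 expr0n.
have vv : 0 < dot v v by rewrite lt0r dot_eq0 v0 dot_ge0.
(* This square equals [dot v v] times the gap in the squared inequality. *)
have := dot_ge0 (dot v v *: u - dot u v *: v).
rewrite !(dotDl, dotDr, dotNl, dotNr, dotZl, dotZr) (dotC v u) => h.
rewrite -subr_ge0 -(pmulr_rge0 _ vv); apply: le_trans h _.
by rewrite le_eqVlt; apply/orP; left; apply/eqP; ring.
Qed.

Lemma dot_le_enorm (R : realType) n (u v : 'cV[R]_n) :
  dot u v <= enorm u * enorm v.
Proof. exact: le_trans (ler_norm _) (cauchy_schwarz u v). Qed.

Lemma enormD (R : realType) n (u v : 'cV[R]_n) :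
  enorm (u + v) <= enorm u + enorm v.
Proof.
rewrite -(ler_pXn2r (n := 2)) ?nnegrE ?addr_ge0 ?enorm_ge0 //.
rewrite sqrrD !enorm_sqr dotDl !dotDr (dotC v u).
by have := dot_le_enorm u v; lra.
Qed.

Lemma enorm_sum (R : realType) n (I : Type) (r : seq I) (P : pred I)
    (F : I -> 'cV[R]_n) :
  enorm (\sum_(j <- r | P j) F j) <= \sum_(j <- r | P j) enorm (F j).
Proof.
elim/big_rec2: _ => [|j a u _ h]; first by rewrite enorm0.
by apply: le_trans (enormD _ _) _; rewrite lerD2l.
Qed.

(** * Spectral norm *)

Lemma norm2_has_ubound (R : realType) m n (M : 'M[R]_(m, n)) :
  has_ubound [set enorm (M *m x) | x in [set x : 'cV[R]_n | enorm x <= 1]].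
Proof.
(* The bound is the Frobenius norm of [M], by Cauchy-Schwarz in each row. *)
exists (Num.sqrt (\sum_j dot (row j M)^T (row j M)^T)) => _ [x /= x1 <-].
apply: ler_wsqrtr; apply: ler_sum => j _.
have -> : (M *m x) j 0 = dot (row j M)^T x.
  by rewrite /dot trmxK -row_mul [RHS]mxE.
rewrite -real_normK ?num_real // -enorm_sqr ler_sqr ?nnegrE ?enorm_ge0 //.
by apply: le_trans (cauchy_schwarz _ _) _; rewrite ler_piMr ?enorm_ge0.
Qed.

Lemma enorm_mulmx_le (R : realType) m n (M : 'M[R]_(m, n)) x :
  enorm (M *m x) <= norm2 M * enorm x.
Proof.
have [->|x0] := eqVneq x 0.
  by rewrite mulmx0 !enorm0 mulr0.
have nx : 0 < enorm x by rewrite lt0r enorm_eq0 x0 enorm_ge0.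
rewrite -ler_pdivrMr //; apply: (ub_le_sup (norm2_has_ubound M)).
have nV : `|(enorm x)^-1| = (enorm x)^-1 by rewrite ger0_norm // invr_ge0 ltW.
exists ((enorm x)^-1 *: x) => /=; first by rewrite enormZ nV mulVf ?gt_eqF.
by rewrite -scalemxAr enormZ nV mulrC.
Qed.

Lemma norm2_ge0 (R : realType) m n (M : 'M[R]_(m, n)) : 0 <= norm2 M.
Proof.
apply: le_trans (enorm_ge0 (M *m 0)) _.
apply: (ub_le_sup (norm2_has_ubound M)); exists 0 => //=.
by rewrite enorm0.
Qed.

(** * Spectral theorem for real symmetric matrices *)

Lemma symm_eigenvector (R : realType) n (A : 'M[R]_n.+1) : A^T = A ->
  exists a v, dot v v = 1 /\ A *m v = a *: v.
Proof.
move=> Asym.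
suff [a /eigenvalueP[v vA v0]] : exists a, eigenvalue A a.
  have w0 : enorm v^T != 0 by rewrite enorm_eq0 trmx_eq0.
  exists a, ((enorm v^T)^-1 *: v^T); split.
    by rewrite -enorm_sqr enormZ ger0_norm ?invr_ge0 ?enorm_ge0 // mulVf ?expr1n.
  by rewrite -scalemxAr -{1}Asym -trmx_mul vA linearZ /= scalerA mulrC scalerA.
pose Ac := map_mx (real_complex R) A.
have Ah : Ac \is hermsymmx.
  apply: realsym_hermsym; last by apply/mxOverP => r c; rewrite mxE complex_real.
  by apply/is_hermitianmxP; rewrite expr0 scale1r map_mx_id // /Ac map_trmx Asym.
have /orthomx_spectralP AcE := hermitian_normalmx Ah.
have := hermitian_spectral_diag_real Ah => /mxOverP/(_ 0 0)/complex_realP[a aE].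
exists a; rewrite eigenvalue_root_char -(fmorph_root (real_complex R)).
rewrite map_char_poly -eigenvalue_root_char -/Ac.
have Pu := spectral_unit Ac.
apply/eigenvalueP; exists (row 0 (spectralmx Ac)).
  rewrite -row_mul {2}AcE -!mulmxA mulKVmx //.
  by apply/matrixP => r c; rewrite mxE mul_diag_mx !mxE aE.
apply: contraTneq isT => r0; have := mulmxV Pu.
move/(congr1 (row 0)); rewrite row_mul r0 mul0mx => /matrixP/(_ 0 0).
by rewrite !mxE eqxx => /esym/eqP; rewrite oner_eq0.
Qed.

Lemma orthogonal_to_e0 (R : realType) n (v : 'cV[R]_(1 + n)) : dot v v = 1 ->
  exists Q : 'M[R]_(1 + n), Q *m Q^T = 1%:M /\ Q *m v = delta_mx 0 0.
Proof.
move=> v1; pose e : 'cV[R]_(1 + n) := delta_mx 0 0.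
have [->|ve] := eqVneq v e.
  by exists 1%:M; rewrite trmx1 !mul1mx.
have ee : dot e e = 1.
  by rewrite /dot /e trmx_delta mul_delta_mx mxE.
pose u : 'cV[R]_(1 + n) := v - e; pose s := dot u u.
have s0 : s != 0 by rewrite dot_eq0 subr_eq0.
have uu : u^T *m u = s%:M by rewrite [LHS]mx11_scalar.
(* As [v] and [e] are unit vectors, both sides are 1 - <e, v>. *)
have uv : u^T *m v = (s / 2)%:M.
  rewrite [LHS]mx11_scalar -/(dot u v); congr _%:M.
  rewrite /s /u !(dotDl, dotDr, dotNl, dotNr) (dotC v e) v1 ee.
  by field.
(* Householder reflection exchanging v and e *)
exists (1%:M - (2 / s) *: (u *m u^T)); split; last first.
  rewrite mulmxBl mul1mx -scalemxAl -mulmxA uv mul_mx_scalar scalerA.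
  have -> : 2 / s * (s / 2) = 1 by field.
  by rewrite scale1r opprB addrCA subrr addr0.
have -> : (1%:M - (2 / s) *: (u *m u^T))^T = 1%:M - (2 / s) *: (u *m u^T).
  by rewrite linearB linearZ /= trmx1 trmx_mul trmxK.
rewrite mulmxBl mul1mx mulmxBr mulmx1 -scalemxAl -scalemxAr.
rewrite -mulmxA (mulmxA u^T) uu mul_scalar_mx -scalemxAr.
move: (u *m u^T) => W; apply/matrixP => r c; rewrite !mxE.
by field.
Qed.

(** Deflation: an orthogonal map takes a unit eigenvector to the first basis vector. This clears the
    first column off the diagonal, symmetry clears the first row, and induction treats the remaining
    block. *)
Lemma symm_spectral (R : realType) n (A : 'M[R]_n) : A^T = A ->
  exists (Q : 'M[R]_n) (a : 'rV[R]_n),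
    Q *m Q^T = 1%:M /\ A = Q^T *m diag_mx a *m Q.
Proof.
elim: n A => [|n IHn] A Asym.
  by exists 1%:M, 0; split; apply/matrixP => - [].
have [a [v [v1 Av]]] := symm_eigenvector Asym.
have [Q [QQ Qv]] := @orthogonal_to_e0 _ n v v1.
have QtQ := mulmx1C QQ.
pose B : 'M[R]_(1 + n) := Q *m A *m Q^T.
have Bsym : B^T = B by rewrite /B !trmx_mul trmxK Asym mulmxA.
have Be : B *m delta_mx 0 0 = a *: (delta_mx 0 0 : 'cV[R]_(1 + n)).
  by rewrite /B -Qv -!mulmxA (mulmxA Q^T) QtQ mul1mx Av -scalemxAr.
have AE : A = Q^T *m B *m Q.
  by rewrite /B -!mulmxA QtQ mulmx1 mulmxA QtQ mul1mx.
clearbody B; have BE : B = block_mx a%:M 0 0 (drsubmx B).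
  have colB : col 0 B = a *: delta_mx 0 0 by rewrite colE Be.
  have B0 j : B j ord0 = a * (j == ord0)%:R.
    by have /matrixP/(_ j 0) := colB; rewrite !mxE andbT.
  have B0' j : B ord0 j = a * (j == ord0)%:R by rewrite -Bsym mxE B0.
  have l0 (r : 'I_1) : lshift n r = ord0 :> 'I_(1 + n).
    by apply: val_inj; rewrite /= ord1.
  have r0 (r : 'I_n) : (rshift 1 r == ord0 :> 'I_(1 + n)) = false by [].
  rewrite -{1}[B]submxK; congr block_mx; apply/matrixP => r c; rewrite !mxE.
  - by rewrite !l0 B0 !ord1 eqxx mulr1.
  - by rewrite l0 B0' r0 mulr0.
  - by rewrite l0 B0 r0 mulr0.
have Dsym : (drsubmx B)^T = drsubmx B by rewrite trmx_drsub Bsym.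
have [P [b [PP DE]]] := IHn _ Dsym.
pose P1 : 'M[R]_(1 + n) := block_mx 1%:M 0 0 P.
have PP1 : P1 *m P1^T = 1%:M.
  rewrite /P1 tr_block_mx mulmx_block !trmx1 !trmx0 !mulmx0 !mul0mx !mul1mx.
  by rewrite !addr0 !add0r PP -scalar_mx_block.
have PE : P1^T *m diag_mx (row_mx a%:M b) *m P1 =
    block_mx a%:M 0 0 (P^T *m diag_mx b *m P).
  rewrite /P1 tr_block_mx diag_mx_row !mulmx_block !trmx1 !trmx0.
  rewrite !mulmx0 !mul0mx !mul1mx !mulmx1 !addr0 !add0r !mul0mx.
  by congr block_mx; apply/matrixP => r c; rewrite !mxE !ord1 eqxx.
exists (P1 *m Q), (row_mx a%:M b); split.
  by rewrite trmx_mul -mulmxA (mulmxA Q) QQ mul1mx.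
rewrite AE BE DE trmx_mul -!mulmxA; congr mulmx; rewrite !mulmxA; congr mulmx.
exact/esym.
Qed.

(** * Eigenvalues as multisets *)

Lemma perm_of_perm_eq (T : eqType) n (c b : 'I_n -> T) :
  perm_eq [seq c j | j <- enum 'I_n] [seq b j | j <- enum 'I_n] ->
  exists s : {perm 'I_n}, forall j, c j = b (s j).
Proof.
move=> /(@tuple_permP _ _ _ [tuple b j | j < n])[s cE]; exists s => j.
have : [tuple c j | j < n] = [tuple tnth [tuple b j | j < n] (s j) | j < n].
  exact: val_inj.
by move/(congr1 (fun t => tnth t j)); rewrite !tnth_mktuple.
Qed.

Lemma sub_multiset_perm (R : eqType) (x0 : R) n (S : {set 'I_n})
    (theta b : 'I_n -> R) rest :
  perm_eq [seq b j | j <- enum 'I_n] ([seq theta p | p <- enum S] ++ rest) ->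
  exists s : {perm 'I_n}, forall p, p \in S -> b (s p) = theta p.
Proof.
move=> bE; pose e := enum (~: S)%SET.
(* [c] spreads [rest] over the complement of [S], so it lists the same multiset as [b]. The default
   [x0] is never reached since [e] and [rest] have equal size. *)
pose c j := if j \in S then theta j else nth x0 rest (index j e).
have sz : size e = size rest.
  have := perm_size bE; rewrite size_cat !size_map -enumT size_enum_ord => nE.
  apply/eqP; rewrite -(eqn_add2l (size (enum S))) -nE /e -!cardE.
  by rewrite cardsC card_ord.
have enumE : perm_eq (enum 'I_n) (enum S ++ e).
  apply: uniq_perm; rewrite ?enum_uniq //.
    rewrite cat_uniq !enum_uniq /= andbT; apply/hasPn => j.
    by rewrite !mem_enum inE.
  by move=> j; rewrite mem_cat !mem_enum !inE orbN.
have cE : perm_eq [seq c j | j <- enum 'I_n] [seq b j | j <- enum 'I_n].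
  apply: perm_trans (perm_map _ enumE) _; rewrite perm_sym map_cat.
  rewrite (_ : map c (enum S) = map theta (enum S)); last first.
    by apply/eq_in_map => j; rewrite mem_enum /c => ->.
  rewrite (_ : map c e = rest) //.
  apply: (@eq_from_nth _ x0) => [|j]; rewrite size_map // => je.
  have n0 : 'I_n by case: (e) je => // y *; exact: y.
  rewrite (nth_map n0) // /c.
  have := mem_nth n0 je; rewrite mem_enum inE => /negbTE ->.
  by rewrite index_uniq // enum_uniq.
have [s sE] := perm_of_perm_eq cE.
by exists s => p pS; rewrite -sE /c pS.
Qed.

Lemma fixed_spectrum (R : realType) n (A : 'M[R]_n) (S : {set 'I_n})
    (theta b : 'I_n -> R) : A^T = A ->
  (forall p j, p \in S -> A p j = theta p *+ (p == j)) -> eigenvalues_of A b ->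
  exists s : {perm 'I_n}, forall p, p \in S -> b (s p) = theta p.
Proof.
move=> Asym AS bE.
(* Replacing the entries theta p by tau does not change the complementary
   block, so both matrices have the same characteristic polynomial up to the
   explicit factors; those are coprime as tau differs from every theta p. *)
have [tau tauS] : exists tau, forall p, tau != theta p.
  (* This value exceeds every [theta p]. *)
  exists (1 + \sum_p `|theta p|) => p; rewrite gt_eqF //.
  rewrite (bigD1 p) //=; have := ler_norm (theta p).
  have : 0 <= \sum_(j | j != p) `|theta j| by apply: sumr_ge0.
  lra.
pose M := \matrix_(r, c) (if (r \in S) || (c \in S) then tau *+ (r == c)
                          else A r c).
pose D f : 'rV[{poly R}]_n := \row_j if j \in S then 'X - (f j)%:P else 1.
have detD f : \det (diag_mx (D f)) = \prod_(j in S) ('X - (f j)%:P).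
  rewrite det_diag [RHS]big_mkcond /=.
  by apply: eq_bigr => j _; rewrite mxE.
have AM : char_poly A * \prod_(j in S) ('X - tau%:P) =
          char_poly M * \prod_(j in S) ('X - (theta j)%:P).
  rewrite -(detD (fun=> tau)) -detD -!det_mulmx; congr (\det _).
  apply/matrixP => r c; rewrite !mul_mx_diag !mxE.
  have AS' p j : p \in S -> A j p = theta p *+ (p == j).
    by move=> pS; rewrite -Asym mxE AS.
  have [cS|cS] := boolP (c \in S).
    rewrite orbT AS' // eq_sym; case: eqP => [->|_].
      by rewrite !mulr1n mulrC.
    by rewrite !mulr0n subrr !mul0r.
  have [rS|rS] //= := boolP (r \in S).
  rewrite AS // (_ : r == c = false) //.
  by apply: contraNF cS => /eqP <-.
have dv : \prod_(x <- [seq theta p | p <- enum S]) ('X - x%:P) %|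
          \prod_(j < n) ('X - (b j)%:P).
  rewrite -bE big_map big_enum /=.
  rewrite -(@Gauss_dvdpl _ _ (\prod_(j in S) ('X - tau%:P))).
    by rewrite AM dvdp_mull.
  rewrite coprimep_sym prodr_const; apply: coprimep_expl.
  rewrite coprimep_sym coprimep_XsubC; apply/negP => /rootP; rewrite horner_prod.
  move/eqP; rewrite prodf_seq_eq0 => /hasP[j _ /andP[_]].
  by rewrite !hornerE subr_eq0 (negbTE (tauS j)).
(* Divisibility between products of linear factors amounts to inclusion of the multisets of
   roots. *)
have [m mE] := dvdp_prod_XsubC dv.
have {mE} : perm_eq [seq theta p | p <- enum S]
                    [seq b j | j <- mask m (index_enum 'I_n)].
  apply: prod_XsubC_eq; rewrite [RHS]big_map.
  by apply/eqP; rewrite -eqp_monic ?monic_prod_XsubC.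
move=> mE; have sub : subseq [seq b j | j <- mask m (index_enum 'I_n)]
                             [seq b j | j <- enum 'I_n].
  by rewrite map_mask enumT; exact: mask_subseq.
have [rest restE] := perm_to_subseq sub.
apply: (@sub_multiset_perm _ 0 _ S _ _ rest); apply: perm_trans restE _.
by rewrite perm_cat2r perm_sym.
Qed.

(** * Minimax comparison of sorted spectra *)

Lemma zero_row_kernel (F : fieldType) n (M N : 'M[F]_n) (r : 'I_n) :
  exists2 x : 'cV[F]_n, x != 0 &
    forall j : 'I_n,
      ((j < r)%N -> (M *m x) j 0 = 0) /\ ((r < j)%N -> (N *m x) j 0 = 0).
Proof.
(* Row r of W is zero: these are n - 1 equations in n unknowns. *)
pose W := \matrix_(p, q) (if (p < r)%N then M p q else
                          if (r < p)%N then N p q else 0).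
have W0 : \det W = 0.
  apply/eqP/det0P; exists (delta_mx 0 r).
    apply: contraTneq isT => /matrixP/(_ 0 r)/eqP.
    by rewrite !mxE !eqxx oner_eq0.
  by rewrite -rowE; apply/matrixP => p q; rewrite !mxE ltnn.
have /eqP/det0P[v v0 vW] : \det W^T = 0 by rewrite det_tr.
exists v^T; first by rewrite trmx_eq0.
have {}vW : W *m v^T = 0 by rewrite -[W]trmxK -trmx_mul vW trmx0.
move=> j; have vWj : \sum_q W j q * v^T q 0 = 0.
  by have /matrixP/(_ j 0) := vW; rewrite [LHS]mxE [RHS]mxE.
split=> jr; rewrite mxE -[RHS]vWj; apply: eq_bigr => q _; congr (_ * _).
  by rewrite mxE jr.
by rewrite mxE jr ltnNge ltnW.
Qed.

(** [Q] gives coordinates in an orthonormal eigenbasis. It is recorded through quadratic forms, the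
    shape in which minimax arguments use it. *)
Definition sorted_spectrum (R : realType) n (A Q : 'M[R]_n) (a : 'I_n -> R) :=
  [/\ eigenvalues_of A a,
      (forall r s : 'I_n, (r <= s)%N -> a r <= a s),
      (forall x, dot x x = \sum_r (Q *m x) r 0 ^+ 2) &
      (forall x, dot x (A *m x) = \sum_r a r * (Q *m x) r 0 ^+ 2)].

Lemma dot_orthogonal (R : realType) n (Q : 'M[R]_n) x : Q *m Q^T = 1%:M ->
  dot (Q *m x) (Q *m x) = dot x x.
Proof. by move=> /mulmx1C QQ; rewrite dot_mulmxl mulmxA QQ mul1mx. Qed.

Lemma char_poly_orthogonal (R : realType) n (A Q : 'M[R]_n) a :
  Q *m Q^T = 1%:M -> A = Q^T *m diag_mx a *m Q -> eigenvalues_of A (a 0).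
Proof.
move=> QQ ->; rewrite /eigenvalues_of.
transitivity (char_poly (diag_mx a)); last first.
  rewrite char_poly_trig ?diag_mx_is_trig //.
  by apply: eq_bigr => j _; rewrite mxE eqxx.
pose Qp := map_mx polyC Q.
have QQp : Qp *m Qp^T = 1%:M.
  by rewrite /Qp map_trmx -map_mxM QQ map_mx1.
rewrite /char_poly.
have -> : char_poly_mx (Q^T *m diag_mx a *m Q) =
    Qp^T *m char_poly_mx (diag_mx a) *m Qp.
  rewrite /char_poly_mx mulmxBr mulmxBl mul_mx_scalar -scalemxAl (mulmx1C QQp).
  by rewrite scalemx1 !map_mxM /Qp map_trmx.
rewrite !det_mulmx mulrAC -det_mulmx (mulmx1C QQp) det1 mul1r //.
Qed.

Lemma symm_sorted_spectrum (R : realType) n (A : 'M[R]_n) : A^T = A ->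
  exists (Q : 'M[R]_n) (a : 'I_n -> R), sorted_spectrum A Q a.
Proof.
move=> Asym; have [Q [d [QQ AE]]] := symm_spectral Asym.
have [s sE] : exists s : {perm 'I_n}, forall p q : 'I_n, (p <= q)%N ->
    d 0 (s p) <= d 0 (s q).
  pose t := sort <=%R [seq d 0 j | j <- enum 'I_n].
  have szt : size t = n by rewrite size_sort size_map size_enum_ord.
  have [|s sE] := @perm_of_perm_eq _ _ (fun j : 'I_n => t`_j) (fun j => d 0 j).
    rewrite (_ : [seq _ | j <- _] = t) ?perm_sort //.
    rewrite -[in RHS](mkseq_nth 0 t) szt /mkseq -val_enum_ord -map_comp.
    by apply: eq_map.
  exists s => p q pq; rewrite -!sE.
  apply: (@sorted_leq_nth _ <=%R) => //; rewrite ?inE ?szt //.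
  - exact: le_trans.
  - exact: sort_sorted le_total _.
exists (row_perm s Q), (fun j => d 0 (s j)).
have QE x j : (row_perm s Q *m x) j 0 = (Q *m x) (s j) 0.
  by rewrite !mxE; apply: eq_bigr => q _; rewrite mxE.
split => //.
- rewrite /eigenvalues_of (char_poly_orthogonal QQ AE).
  exact: (reindex_inj (@perm_inj _ s)).
- move=> x; rewrite -(dot_orthogonal x QQ) dotvv_sum (reindex_inj (@perm_inj _ s)).
  by apply: eq_bigr => j _; rewrite QE.
move=> x; rewrite {1}AE dotC -!mulmxA dot_mulmxl trmxK mul_diag_mx dotE.
rewrite (reindex_inj (@perm_inj _ s)); apply: eq_bigr => j _.
by rewrite QE mxE expr2 mulrA.
Qed.

(** If [a r > al], take a nonzero [x] whose A-coordinates below [r] vanish, while the B-coordinates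
    of [L *m x] above [r] vanish. The shifted form of [A] is then positive at [x], and that of [B]
    is at most 0 at [L *m x]. *)
Lemma sorted_compare_le (R : realType) n (A B Qa Qb L : 'M[R]_n) a b al be r :
  sorted_spectrum A Qa a -> sorted_spectrum B Qb b ->
  (forall x, dot x (A *m x) - al * dot x x <=
     dot (L *m x) (B *m (L *m x)) - be * dot (L *m x) (L *m x)) ->
  b r <= be -> a r <= al.
Proof.
move=> [_ asort aQ aA] [_ bsort bQ bB] AB br; rewrite leNgt; apply/negP => ar.
have [x x0 xr] := zero_row_kernel Qa (Qb *m L) r.
have := AB x; apply/negP; rewrite -ltNge.
have x1 : 0 < dot x x by rewrite lt0r dot_eq0 x0 dot_ge0.
apply: (@le_lt_trans _ _ 0).
  rewrite bB bQ mulr_sumr -sumrB sumr_le0 // => j _; rewrite -mulrBl mulmxA.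
  have [jr|rj] := leqP j r; last by rewrite (xr j).2 // expr0n mulr0.
  by rewrite mulr_le0_ge0 ?sqr_ge0 // subr_le0; apply: le_trans (bsort _ _ jr) _.
have : 0 < (a r - al) * dot x x by rewrite mulr_gt0 // subr_gt0.
move/lt_le_trans; apply; rewrite aA aQ !mulr_sumr -sumrB ler_sum // => j _.
rewrite -mulrBl; have [jr|rj] := ltnP j r.
  by rewrite (xr j).1 // expr0n !mulr0.
by rewrite ler_wpM2r ?sqr_ge0 // lerD2r asort.
Qed.

(** Mirror image of [sorted_compare_le]: the vanishing conditions below and above [r] trade
    places. *)
Lemma sorted_compare_ge (R : realType) n (A B Qa Qb L : 'M[R]_n) a b al be r :
  sorted_spectrum A Qa a -> sorted_spectrum B Qb b ->
  (forall x, dot (L *m x) (B *m (L *m x)) - be * dot (L *m x) (L *m x) <=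
     dot x (A *m x) - al * dot x x) ->
  be <= b r -> al <= a r.
Proof.
move=> [_ asort aQ aA] [_ bsort bQ bB] AB br; rewrite leNgt; apply/negP => ar.
have [x x0 xr] := zero_row_kernel (Qb *m L) Qa r.
have := AB x; apply/negP; rewrite -ltNge.
have x1 : 0 < dot x x by rewrite lt0r dot_eq0 x0 dot_ge0.
apply: (@lt_le_trans _ _ 0).
  have : (a r - al) * dot x x < 0 by rewrite pmulr_llt0 // subr_lt0.
  apply: le_lt_trans; rewrite aA aQ !mulr_sumr -sumrB ler_sum // => j _.
  rewrite -mulrBl; have [jr|rj] := leqP j r; last first.
    by rewrite (xr j).2 // expr0n !mulr0.
  by rewrite ler_wpM2r ?sqr_ge0 // lerD2r asort.
rewrite bB bQ mulr_sumr -sumrB sumr_ge0 // => j _; rewrite -mulrBl mulmxA.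
have [jr|rj] := ltnP j r; first by rewrite (xr j).1 // expr0n mulr0.
by rewrite mulr_ge0 ?sqr_ge0 // subr_ge0; apply: le_trans (bsort _ _ rj).
Qed.

(** In an orthonormal eigenbasis A - lam multiplies each coordinate by some [a 0 p - lam], and every
    [a 0 p] occurs among the [mu j], as both list the roots of the characteristic polynomial. *)
Lemma resolvent_bound (R : realType) n (A : 'M[R]_n) mu lam delta w :
  A^T = A -> eigenvalues_of A mu -> 0 <= delta ->
  (forall j, delta <= `|lam - mu j|) ->
  delta * enorm w <= enorm (A *m w - lam *: w).
Proof.
move=> Asym muE d0 hd; have [Q [a [QQ AE]]] := symm_spectral Asym.
have hda p : delta <= `|a 0 p - lam|.
  have : root (char_poly A) (a 0 p).
    rewrite (char_poly_orthogonal QQ AE) -(big_map (a 0) predT (fun x => 'X - x%:P)).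
    by rewrite root_prod_XsubC map_f // mem_index_enum.
  rewrite muE -(big_map mu predT (fun x => 'X - x%:P)) root_prod_XsubC.
  by case/mapP => j _ ->; rewrite distrC.
have QtQ := mulmx1C QQ.
have QQ' : Q^T *m Q^T^T = 1%:M by rewrite trmxK.
have -> : A *m w - lam *: w = Q^T *m (diag_mx a *m (Q *m w) - lam *: (Q *m w)).
  by rewrite AE mulmxBr -scalemxAr !mulmxA QtQ mul1mx.
rewrite -[delta]ger0_norm // -enormZ enorm_le dot_orthogonal //.
rewrite dotZl dotZr -(dot_orthogonal w QQ) !dotvv_sum !mulr_sumr.
apply: ler_sum => p _; move: (Q *m w) => y.
have -> : (diag_mx a *m y - lam *: y) p 0 = (a 0 p - lam) * y p 0.
  by rewrite mul_diag_mx !mxE; ring.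
rewrite exprMn mulrA -expr2 ler_wpM2r ?sqr_ge0 //.
by rewrite -[leRHS]real_normK ?num_real // ler_sqr ?nnegrE.
Qed.

Lemma mulmx_diag_col (R : realType) m k (E : 'M[R]_(m, k)) (D : 'rV[R]_k) w :
  E *m (diag_mx D *m w) = \sum_p (D 0 p * w p 0) *: col p E.
Proof.
apply/matrixP => r c; rewrite !mxE summxE; apply: eq_bigr => p _.
by rewrite mul_diag_mx !mxE ord1 mulrC.
Qed.

(** * Continuity and a mean value estimate *)

Lemma dot_continuous (R : realType) n (v : 'cV[R]_n) : continuous (dot v).
Proof.
rewrite (_ : dot v = fun y => \sum_(j <- index_enum 'I_n) v j 0 * y j 0);
  last by apply/funext => y; rewrite dotE.
elim: (index_enum _) => [|j r IHr].
  rewrite (_ : (fun _ => _) = cst 0); first exact: cst_continuous.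
  by apply/funext => y; rewrite big_nil.
rewrite (_ : (fun _ => _) = (fun y : 'cV[R]_n => v j 0 * y j 0) \+
    (fun y : 'cV[R]_n => \sum_(j <- r) v j 0 * y j 0)); last first.
  by apply/funext => y; rewrite big_cons.
move=> y; refine (cvgD _ (IHr y)).
by apply: cvgM; [exact: cvg_cst | exact: coord_continuous].
Qed.

(** [2 * eta * t] has integral [eta] over [0, 1]. Instead of integrating, the mean value theorem is
    applied to [g t - eta * t ^+ 2], once with [g] equal to [f] and once to its opposite. *)
Lemma derivative_linear_bound (R : realType) (f df : R -> R) (eta : R) :
  {within `[0, 1], continuous f} ->
  (forall t : R, 0 < t < 1 -> is_derive t 1 f (df t) /\ `|df t| <= 2 * eta * t) ->
  `|f 1 - f 0| <= eta.
Proof.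
move=> fc fd.
suff H (g dg : R -> R) : {within `[0, 1], continuous g} ->
    (forall t : R, 0 < t < 1 -> is_derive t 1 g (dg t) /\ dg t <= 2 * eta * t) ->
    g 1 - g 0 <= eta.
  rewrite ler_norml; apply/andP; split.
    rewrite lerNl opprB -[f 0]opprK addrC.
    apply: (H (fun t => - f t) (fun t => - df t)).
      by move=> t; apply: continuousN; exact: fc.
    move=> t /fd[dt]; rewrite ler_norml => /andP[h _]; split; last by move: h; lra.
    exact: is_deriveN.
  apply: (H f df fc) => t /fd[dt]; rewrite ler_norml => /andP[_ h]; split => //.
move=> gc gd; pose h t := g t - eta * t ^+ 2.
have hc : {within `[0, 1], continuous h}.
  rewrite (_ : h = g - (fun t => eta * t ^+ 2)) //; apply: within_continuousB gc _.
  apply: continuous_subspaceT => s.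
  by apply: cvgM; [exact: cvg_cst | exact: exprn_continuous].
have hd (t : R) : t \in `]0, 1[ -> is_derive t 1 h (dg t - eta * (2 * t)).
  rewrite in_itv /= => /gd[dt _].
  have dX : is_derive t 1 (eta \*: (id ^+ 2)) (eta *: ((2%:R * t ^+ 1) *: (1:R))).
    exact: is_deriveZ.
  have := is_deriveB dt dX; rewrite (_ : g - eta \*: id ^+ 2 = h).
    by rewrite expr1 [X in is_derive _ _ _ (_ - eta * X)]mulr1.
  by apply/funext => s; rewrite /h /= [LHS]/(_ - _).
have [c cI] := MVT ltr01 hd hc.
rewrite subr0 mulr1 /h expr1n expr0n /= mulr0 subr0 mulr1 => hE.
have := cI; rewrite in_itv /= => /gd[_]; move: hE; lra.
Qed.



(** * Schur complement of the coordinates outside the cluster *)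

Section Cluster.
Variables (R : realType) (k m i l : nat).
Variables (theta : 'rV[R]_k) (E : 'M[R]_(m, k)) (A2 : 'M[R]_m) (mu : 'I_m -> R).
Hypotheses (A2sym : A2^T = A2) (hmu : eigenvalues_of A2 mu).
Hypothesis hil : (i + l <= k)%N.

Local Notation I := (cluster_set k i l).
Local Notation EI := (cluster_cols hil E).

Definition clP : 'M[R]_k := diag_mx (\row_p (p \in I)%:R).

(** Resolvent of the diagonal block outside the cluster, extended by zero so that
    [E *m offD lam *m E^T] is the sum over p notin I in S(lam). *)
Definition offD (lam : R) : 'M[R]_k :=
  diag_mx (\row_p (if p \in I then 0 else (theta 0 p - lam)^-1)).

(* The Schur complement of A(t) - lam with respect to the coordinates p notin I,
   restricted to the block of A2; it does not depend on t. *)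
Definition schur (lam : R) : 'M[R]_m := A2 - lam%:M - E *m offD lam *m E^T.

(** Completes the square: when S(lam) is invertible and [lam] differs from every theta_p with p
    notin I, it sends x to x + v, where (A(0) - lam) v = (0, E P x1). *)
Definition schur_shear (lam : R) : 'M[R]_(k + m) :=
  block_mx (1%:M - offD lam *m E^T *m (invmx (schur lam) *m E *m clP)) 0
           (invmx (schur lam) *m E *m clP) 1%:M.

Lemma clP_tr : clP^T = clP. Proof. exact: tr_diag_mx. Qed.

Lemma clPE (x : 'cV[R]_k) p c : (clP *m x) p c = (p \in I)%:R * x p c.
Proof. by rewrite mul_diag_mx !mxE. Qed.

Lemma clP_offD lam : clP *m offD lam = 0.
Proof.
apply/matrixP => p q; rewrite mul_diag_mx !mxE.
by case: (p \in I); rewrite ?mul0r // mul0rn mulr0.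
Qed.

Lemma enorm_clP x : enorm (clP *m x) <= enorm x.
Proof.
rewrite enorm_le !dotvv_sum; apply: ler_sum => p _; rewrite clPE exprMn.
by rewrite ler_piMl ?sqr_ge0 //; case: (p \in I); rewrite ?expr1n ?expr0n.
Qed.

Lemma enorm_clcols x : enorm (E *m (clP *m x)) <= norm2 EI * enorm (clP *m x).
Proof.
(* [E *m clP] sees only the cluster entries of [x], so it acts as [EI] on the subvector [u]. *)
pose u := \col_q x (cluster_idx hil q) 0.
have reidx (f : 'I_k -> R) :
    \sum_(p in I) f p = \sum_q f (cluster_idx hil q).
  rewrite (_ : I = [set cluster_idx hil q | q in 'I_l]%SET).
    by rewrite big_imset //= => q q' _ _ /(congr1 val)/addnI/val_inj.
  apply/setP => p; rewrite inE; apply/idP/imsetP => [/andP[ip pl]|[q _ ->]].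
    have ql : (p - i < l)%N by rewrite ltn_subLR.
    by exists (Ordinal ql) => //; apply: val_inj; rewrite /= subnKC.
  by rewrite /= leq_addr ltn_add2l ltn_ord.
have -> : E *m (clP *m x) = EI *m u.
  apply/matrixP => r c; rewrite ord1 !mxE.
  transitivity (\sum_(p in I) E r p * x p 0).
    rewrite [RHS]big_mkcond; apply: eq_bigr => p _; rewrite clPE.
    by case: (p \in I); rewrite ?mul1r // mul0r mulr0.
  by rewrite reidx; apply: eq_bigr => q _; rewrite !mxE.
have -> : enorm (clP *m x) = enorm u.
  congr Num.sqrt; transitivity (\sum_(p in I) x p 0 ^+ 2).
    rewrite [RHS]big_mkcond; apply: eq_bigr => p _; rewrite clPE.
    by case: (p \in I); rewrite ?mul1r // mul0r expr0n.
  by rewrite reidx; apply: eq_bigr => q _; rewrite !mxE.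
exact: enorm_mulmx_le.
Qed.

(** A2 - lam expands [w] by at least [delta], and each rank-one term of S(lam) takes away at most
    |E_p|^2 / deltaJ p. What remains is 1 / d. *)
Lemma schur_bound lam delta (deltaJ : 'I_k -> R) w :
  0 <= delta -> (forall j, delta <= `|lam - mu j|) ->
  (forall p, p \notin I -> 0 < deltaJ p <= `|lam - theta 0 p|) ->
  0 < d_coef i l E delta deltaJ ->
  enorm w <= d_coef i l E delta deltaJ * enorm (schur lam *m w).
Proof.
move=> d0 hd hJ; rewrite /d_coef invr_gt0; set s := \sum_(p | _) _ => ds.
rewrite mulrC ler_pdivlMr // mulrC mulrBl lerBlDr.
have := resolvent_bound w A2sym hmu d0 hd; move/le_trans; apply.
rewrite (_ : _ - _ = schur lam *m w + E *m (offD lam *m (E^T *m w))); last first.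
  by rewrite /schur !mulmxBl mul_scalar_mx -!mulmxA subrK.
apply: le_trans (enormD _ _) _; rewrite lerD2l mulmx_diag_col.
apply: le_trans (enorm_sum _ _ _) _; rewrite mulr_suml [leRHS]big_mkcond.
apply: ler_sum => p _; rewrite mxE enormZ norm2_cV.
have [pI|pI] /= := boolP (p \in I); first by rewrite mul0r normr0 mul0r.
have [Jp Jl] := andP (hJ p pI).
have -> : (E^T *m w) p 0 = dot (col p E) w.
  by rewrite /dot tr_col -row_mul [RHS]mxE.
have Jinv : `|theta 0 p - lam|^-1 <= (deltaJ p)^-1.
  by rewrite lef_pV2 ?posrE // distrC // (lt_le_trans Jp).
rewrite normrM normfV.
have -> : enorm (col p E) ^+ 2 / deltaJ p * enorm w =
  (deltaJ p)^-1 * (enorm (col p E) * enorm w) * enorm (col p E) by ring.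
rewrite ler_wpM2r ?enorm_ge0 //; apply: ler_pM => //; last exact: cauchy_schwarz.
Qed.

(** * The family A(t) and elimination outside the cluster *)

Local Notation At t := (ritz_mx theta (scale_cluster i l t E) A2).

Lemma scale_clusterE t : scale_cluster i l t E = E - (1 - t) *: (E *m clP).
Proof.
apply/matrixP => r p; rewrite /clP mul_mx_diag !mxE.
by case: (p \in I); rewrite ?mulr1 ?mulr0 ?subr0 //; ring.
Qed.

Lemma scale_cluster1 : scale_cluster i l 1 E = E.
Proof. by rewrite scale_clusterE subrr scale0r subr0. Qed.

Lemma ritz_sym t : (At t)^T = At t.
Proof. by rewrite /ritz_mx tr_block_mx tr_diag_mx A2sym trmxK. Qed.

Lemma ritz_mul t (x1 : 'cV[R]_k) (x2 : 'cV[R]_m) : At t *m col_mx x1 x2 =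
  col_mx (diag_mx theta *m x1 + (E^T *m x2 - (1 - t) *: (clP *m (E^T *m x2))))
         (E *m x1 - (1 - t) *: (E *m (clP *m x1)) + A2 *m x2).
Proof.
rewrite /ritz_mx mul_block_col scale_clusterE; congr col_mx.
  by rewrite linearB linearZ /= trmx_mul clP_tr mulmxBl -scalemxAl mulmxA.
by rewrite mulmxBl -scalemxAl mulmxA.
Qed.

Lemma dot_ritz t x1 x2 y1 y2 :
  dot (col_mx y1 y2) (At t *m col_mx x1 x2) =
  dot (col_mx y1 y2) (At 0 *m col_mx x1 x2) +
  t * (dot (E *m (clP *m y1)) x2 + dot (E *m (clP *m x1)) y2).
Proof.
rewrite !ritz_mul !dot_col_mx !(dotDr, dotNr, dotZr).
have -> : dot (E *m (clP *m y1)) x2 = dot y1 (clP *m (E^T *m x2)).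
  by rewrite !dot_mulmxl clP_tr.
by rewrite (dotC y2 (E *m (clP *m x1))); ring.
Qed.

(** The first block of [v] solves the rows p notin I and vanishes on the cluster, which A(0)
    decouples. The last block of rows then reads S(lam) w. *)
Lemma schur_solution lam (w : 'cV[R]_m) (g : 'cV[R]_k) :
  (forall p, p \notin I -> theta 0 p != lam) ->
  schur lam *m w = E *m (clP *m g) ->
  let v := col_mx (- (offD lam *m (E^T *m w))) w in
  At 0 *m v - lam *: v = col_mx 0 (E *m (clP *m g)).
Proof.
move=> hlam <- v; rewrite /v ritz_mul scale_col_mx opp_col_mx add_col_mx.
congr col_mx.
  apply/matrixP => p c; rewrite ord1; move: (E^T *m w) => y.
  rewrite subr0 scale1r /offD /clP !mul_diag_mx !mxE.
  have [pI|/hlam pl] := boolP (p \in I); first by rewrite mul1r; ring.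
  by rewrite mul0r; field; rewrite subr_eq0.
rewrite subr0 scale1r [clP *m - _]mulmxN (mulmxA clP) clP_offD mul0mx oppr0.
rewrite mulmx0 subr0.
rewrite /schur !mulmxBl mul_scalar_mx mulmxN !mulmxA.
by rewrite -addrA addrC.
Qed.

Lemma schur_eigenvector lam t (x1 : 'cV[R]_k) (x2 : 'cV[R]_m) :
  (forall p, p \notin I -> theta 0 p != lam) ->
  At t *m col_mx x1 x2 = lam *: col_mx x1 x2 ->
  schur lam *m x2 = - (t *: (E *m (clP *m x1))).
Proof.
move=> hlam; rewrite ritz_mul scale_col_mx => /eq_col_mx[e1 e2].
(* The rows p notin I of the eigenvector equation determine [x1] outside the cluster. *)
have x1E : x1 = clP *m x1 - offD lam *m (E^T *m x2).
  apply/matrixP => p c; have /matrixP/(_ p c) := e1.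
  move: (E^T *m x2) => y; rewrite /offD /clP !mul_diag_mx !mxE.
  have [pI|/hlam pl] := boolP (p \in I); first by move=> _; rewrite mul1r mul0r subr0.
  rewrite !mul0r mulr0 subr0 sub0r => e.
  have nz : theta 0 p - lam != 0 by rewrite subr_eq0.
  by apply: (mulfI nz); rewrite mulrN mulrA divff // mul1r mulrBl; move: e; lra.
rewrite /schur !mulmxBl mul_scalar_mx -e2 -!mulmxA.
rewrite {1}x1E mulmxBr; move: (E *m (clP *m x1)) (E *m (_ *m (_ *m _))) (A2 *m x2).
move=> a b c; apply/matrixP => p q; rewrite !mxE; ring.
Qed.

(** From t = 0 to t = 1 the form at x gains 2 <g, x2>. Shifting x to x + v in the form of A(0) - lam
    gains 2 <g, x2> + <g, w>, because (A(0) - lam) v = (0, g). *)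
Lemma schur_congruence lam (x1 : 'cV[R]_k) (x2 : 'cV[R]_m)
    (x := col_mx x1 x2) (L := schur_shear lam) (g := E *m (clP *m x1)) :
  (forall p, p \notin I -> theta 0 p != lam) -> schur lam \in unitmx ->
  dot x (At 1 *m x) - lam * dot x x =
  dot (L *m x) (At 0 *m (L *m x)) - lam * dot (L *m x) (L *m x)
  - dot (invmx (schur lam) *m g) g.
Proof.
move=> hlam Su; pose w := invmx (schur lam) *m g.
pose v := col_mx (- (offD lam *m (E^T *m w))) w.
have vE : At 0 *m v - lam *: v = col_mx 0 g.
  by apply: schur_solution => //; rewrite /w mulKVmx.
have -> : L *m x = x + v.
  rewrite /L /schur_shear mul_block_col !mul0mx mul1mx addr0 mulmxBl mul1mx add_col_mx.
  by rewrite /w /g !mulmxA [x2 + _]addrC.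
have Av : At 0 *m v = lam *: v + col_mx 0 g by rewrite -vE addrC subrK.
have Avx : dot v (At 0 *m x) = dot (lam *: v + col_mx 0 g) x.
  by rewrite -Av [RHS]dot_mulmxl ritz_sym.
rewrite {1}/x dot_ritz -/x mulmxDr Av !(dotDl, dotDr, dotZr) Avx.
rewrite dotDl dotZl (dotC v x) /x /v !dot_col_mx.
have -> : dot (x1) (0 : 'cV[R]_k) = 0 by rewrite /dot mulmx0 mxE.
have -> : dot (0 : 'cV[R]_k) x1 = 0 by rewrite dotC /dot mulmx0 mxE.
have -> : dot (- (offD lam *m (E^T *m w))) 0 = 0 by rewrite /dot mulmx0 mxE.
rewrite -/g (dotC x2 g) -/w; ring.
Qed.

Lemma schur_term_bound lam d
     (x1 : 'cV[R]_k) (x2 : 'cV[R]_m)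
    (x := col_mx x1 x2) (L := schur_shear lam) (g := E *m (clP *m x1)) :
  0 <= d -> (forall w, enorm w <= d * enorm (schur lam *m w)) ->
  schur lam \in unitmx ->
  `|dot (invmx (schur lam) *m g) g| <=
    d * norm2 EI ^+ 2 * dot (L *m x) (L *m x).
Proof.
move=> d0 hS Su.
have g1 : enorm g <= norm2 EI * enorm (L *m x).
  apply: le_trans (enorm_clcols _) _; rewrite ler_wpM2l ?norm2_ge0 //.
  rewrite /L /schur_shear mul_block_col !mul0mx mul1mx addr0.
  (* The shear keeps the cluster entries of [x1], so [g] is controlled by [L *m x] itself. *)
  set y1 := (_ - _) *m x1; have <- : clP *m y1 = clP *m x1.
    by rewrite /y1 mulmxBl mul1mx mulmxBr !mulmxA clP_offD !mul0mx subr0.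
  apply: le_trans (enorm_clP _) _.
  by rewrite enorm_le dot_col_mx lerDl dot_ge0.
apply: le_trans (cauchy_schwarz _ _) _.
apply: le_trans (_ : d * enorm g * enorm g <= _).
  by rewrite ler_wpM2r ?enorm_ge0 //; apply: le_trans (hS _) _; rewrite mulKVmx.
rewrite -!mulrA ler_wpM2l // -enorm_sqr -expr2 mulrA -expr2 -exprMn.
by rewrite ler_sqr ?nnegrE ?mulr_ge0 ?enorm_ge0 ?norm2_ge0.
Qed.

Lemma schur_unit lam d : (forall w, enorm w <= d * enorm (schur lam *m w)) ->
  schur lam \in unitmx.
Proof.
move=> hS; rewrite unitmxE unitfE -det_tr; apply/det0P => -[v v0 vS].
have {}vS : schur lam *m v^T = 0 by rewrite -[schur lam]trmxK -trmx_mul vS trmx0.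
have := hS v^T; rewrite vS enorm0.
by rewrite mulr0 le_eqVlt ltNge enorm_ge0 orbF enorm_eq0 trmx_eq0 (negbTE v0).
Qed.

(** At t = 0 each cluster row of the matrix has only its diagonal entry theta_p. *)
Lemma fixed_spectrum_ritz (b : 'I_(k + m) -> R) : eigenvalues_of (At 0) b ->
  exists s : {perm 'I_(k + m)}, forall p, p \in I -> b (s (lshift m p)) = theta 0 p.
Proof.
move=> bE; pose th := row_mx theta (0 : 'rV[R]_m).
have [|s sE] := fixed_spectrum (S := [set lshift m p | p in I]%SET)
    (theta := th 0) (ritz_sym 0) _ bE.
  move=> _ j /imsetP[p pI ->]; rewrite /th row_mxEl /ritz_mx.
  case: (split_ordP j) => {}j ->.
    by rewrite block_mxEul mxE (inj_eq (@lshift_inj _ _)).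
  by rewrite block_mxEur !mxE pI mul0r eq_lrshift.
by exists s => p pI; rewrite sE ?imset_f // /th row_mxEl.
Qed.

(** * Eigenvalues of A near the cluster *)

Lemma cluster_eigenvalues (lambda0 Delta delta : R) (deltaJ : 'I_k -> R) :
  (forall p, p \in I -> `|theta 0 p - lambda0| <= Delta) ->
  (forall lam, `|lam - lambda0| <= Delta + norm2 EI ->
     (forall j, delta <= `|lam - mu j|) /\
     (forall p, p \notin I -> 0 < deltaJ p <= `|lam - theta 0 p|)) ->
  0 <= delta -> 0 < d_coef i l E delta deltaJ ->
  exists lam : 'I_(k + m) -> R,
    eigenvalues_of (ritz_mx theta E A2) lam /\
    forall p, p \in I ->
      `|lam (lshift m p) - theta 0 p| <=
        d_coef i l E delta deltaJ * norm2 EI ^+ 2.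
Proof.
move=> hint hnear delta0; set d := d_coef _ _ _ _ _ => d0.
rewrite -[X in ritz_mx _ X _]scale_cluster1.
have [Qa [a aS]] := symm_sorted_spectrum (ritz_sym 1).
have [Qb [b bS]] := symm_sorted_spectrum (ritz_sym 0).
have [s sE] : exists s : {perm 'I_(k + m)}, forall p, p \in I ->
    b (s (lshift m p)) = theta 0 p by apply: fixed_spectrum_ritz; case: bS.
(* Position p in I receives the eigenvalue of A whose rank is that of theta_p in the sorted spectrum
   of A(0). *)
exists (fun q => a (s q)); split.
  rewrite /eigenvalues_of; have [-> _ _ _] := aS.
  exact: (reindex_inj (@perm_inj _ s)).
move=> p pI; move: (s _) (sE p pI) => r br.
set eta := d * norm2 EI ^+ 2; rewrite ler_distl.
have [le_eta|/ltW eta_le] := leP eta (norm2 EI); last first.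
  (* The forms differ by 2 <E P x1, x2>, and 2 |x1| |x2| is at most |x|^2. *)
  have pert x : `|dot x (At 1 *m x) - dot x (At 0 *m x)| <= norm2 EI * dot x x.
    rewrite -[x]vsubmxK; move: (usubmx x) (dsubmx x) => x1 x2.
    rewrite [X in X - _]dot_ritz mul1r addrAC subrr add0r dot_col_mx.
    have gx : `|dot (E *m (clP *m x1)) x2| <= norm2 EI * (enorm x1 * enorm x2).
      apply: le_trans (cauchy_schwarz _ _) _; rewrite mulrA ler_wpM2r ?enorm_ge0 //.
      apply: le_trans (enorm_clcols _) _; rewrite ler_wpM2l ?norm2_ge0 //.
      exact: enorm_clP.
    apply: le_trans (ler_normD _ _) _; rewrite -mulr2n -mulr_natl.
    apply: le_trans (ler_wpM2l _ gx) _ => //.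
    rewrite mulrCA ler_wpM2l ?norm2_ge0 // -!enorm_sqr.
    by have := sqr_ge0 (enorm x1 - enorm x2); lra.
  apply/andP; split.
    apply: (sorted_compare_ge (L := 1%:M) (be := theta 0 p) aS bS); last by rewrite br.
    move=> x; rewrite !mul1mx; have := pert x; rewrite ler_norml => /andP[h _].
    have := ler_wpM2r (dot_ge0 x) eta_le; lra.
  apply: (sorted_compare_le (L := 1%:M) (be := theta 0 p) aS bS); last by rewrite br.
  move=> x; rewrite !mul1mx; have := pert x; rewrite ler_norml => /andP[_ h].
  have := ler_wpM2r (dot_ge0 x) eta_le; lra.
have eta0 : 0 <= eta by rewrite mulr_ge0 ?sqr_ge0 // ltW.
have key al : `|al - theta 0 p| <= eta -> exists L : 'M[R]_(k + m), forall x,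
    `|(dot x (At 1 *m x) - al * dot x x) -
      (dot (L *m x) (At 0 *m (L *m x)) - al * dot (L *m x) (L *m x))|
    <= eta * dot (L *m x) (L *m x).
  move=> hal; have [|h1 h2] := hnear al.
    apply: le_trans (ler_distD (theta 0 p) _ _) _; rewrite addrC.
    by rewrite lerD ?hint //; apply: le_trans hal _.
  have hS w := schur_bound w delta0 h1 h2 d0.
  have hne q : q \notin I -> theta 0 q != al.
    move=> /h2 /andP[J0 Jl]; apply: contraTneq J0 => e; move: Jl.
    by rewrite e subrr normr0 leNgt.
  have Su := schur_unit hS.
  exists (schur_shear al) => x; rewrite -[x]vsubmxK.
  rewrite (schur_congruence _ _ hne Su) distrC opprB addrCA subrr addr0.
  exact: schur_term_bound (ltW d0) hS Su.
(* The error is measured by [L *m x], so it is absorbed into the shift of A(0): with al = theta_p -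
   eta or theta_p + eta, that shift becomes theta_p, the eigenvalue of rank [r]. *)
apply/andP; split.
  have [|L hL] := key (theta 0 p - eta).
    by rewrite addrAC subrr add0r normrN ger0_norm.
  apply: (sorted_compare_ge (L := L) (be := theta 0 p) aS bS); last by rewrite br.
  by move=> x; have := hL x; rewrite ler_norml => /andP[h _]; move: h; lra.
have [|L hL] := key (theta 0 p + eta).
  by rewrite addrAC subrr add0r ger0_norm.
apply: (sorted_compare_le (L := L) (be := theta 0 p) aS bS); last by rewrite br.
by move=> x; have := hL x; rewrite ler_norml => /andP[_ h]; move: h; lra.
Qed.

(** * Differentiation along eigenpaths *)

Definition coupling (y : 'cV[R]_(k + m)) : 'cV[R]_(k + m) :=
  col_mx (clP *m (E^T *m dsubmx y)) (E *m (clP *m usubmx y)).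

(** [coupling] applies A(1) - A(0), which is the derivative of A(t) in t. *)
Lemma dot_ritz_coupling t (x y : 'cV[R]_(k + m)) :
  dot y (At t *m x) = dot y (At 0 *m x) + t * dot (coupling y) x.
Proof.
rewrite -[x]vsubmxK -[y]vsubmxK.
move: (usubmx x) (dsubmx x) (usubmx y) (dsubmx y) => x1 x2 y1 y2.
rewrite dot_ritz /coupling col_mxKu col_mxKd [X in _ = _ + t * X]dot_col_mx.
have -> : dot (E *m (clP *m x1)) y2 = dot (clP *m (E^T *m y2)) x1.
  by rewrite [RHS]dotC 2![LHS]dot_mulmxl clP_tr.
by rewrite [X in _ + t * X = _]addrC.
Qed.

(** Pair each eigenvector equation with the other eigenvector; by symmetry the A(0) terms cancel.
    This is an exact difference quotient for [lam] with no derivative of [x]. *)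
Lemma eigenpath_diff (x : R -> 'cV[R]_(k + m)) (lam : R -> R) (s t : R) :
  At s *m x s = lam s *: x s -> At t *m x t = lam t *: x t ->
  (lam s - lam t) * dot (x t) (x s) = (s - t) * dot (coupling (x t)) (x s).
Proof.
move=> hs ht.
have es : lam s * dot (x t) (x s) =
    dot (x t) (At 0 *m x s) + s * dot (coupling (x t)) (x s).
  by rewrite -dot_ritz_coupling hs dotZr.
have et : lam t * dot (x t) (x s) =
    dot (x t) (At 0 *m x s) + t * dot (coupling (x t)) (x s).
  by rewrite -dot_ritz_coupling -[At t]ritz_sym -dot_mulmxl ht dotZl.
by rewrite !mulrBl es et; ring.
Qed.

(** Let s tend to t in [eigenpath_diff]: continuity of [x] gives the limit and keeps
    [dot (x t) (x s)] away from 0 near t. *)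
Lemma eigenpath_derive (x : R -> 'cV[R]_(k + m)) (lam : R -> R) :
  {within `[0, 1], continuous x} ->
  (forall t : R, 0 <= t <= 1 -> x t <> 0 /\ At t *m x t = lam t *: x t) ->
  forall t : R, 0 < t < 1 ->
    is_derive t 1 lam (dot (coupling (x t)) (x t) / dot (x t) (x t)).
Proof.
move=> xc hx t t01.
have cdot v : (dot v (x s)) @[s --> t] --> dot v (x t).
  apply: (@within_continuous_continuous _ _ _ 0 1 (fun s => dot v (x s))) => //.
  apply: within_continuous_comp xc => y _; exact: dot_continuous.
have tI : 0 <= t <= 1 by case/andP: t01 => /ltW-> /ltW->.
have [/eqP xt0 xtE] := hx t tI.
have xx : dot (x t) (x t) != 0 by rewrite dot_eq0.
have lim : (dot (coupling (x t)) (x s) / dot (x t) (x s)) @[s --> t] -->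
    dot (coupling (x t)) (x t) / dot (x t) (x t).
  by apply: cvgM (cdot _) (cvgV xx (cdot _)).
have sh : (h + t) @[h --> (0:R)^'] --> t.
  have sh0 : (h + t) @[h --> (0:R)] --> t.
    by rewrite -[X in _ --> X](add0r t); apply: cvgD; [exact: cvg_id | exact: cvg_cst].
  apply: cvg_trans sh0; apply: cvg_app; exact: nbhs_dnbhs.
have H : h^-1 *: ((lam \o shift t) (h *: (1:R)) - lam t) @[h --> 0^'] -->
    dot (coupling (x t)) (x t) / dot (x t) (x t).
  apply: cvg_trans (cvg_comp _ _ sh lim); apply: near_eq_cvg.
  near=> h.
  have h0 : h != 0 by near: h; exact: nbhs_dnbhs_neq.
  have hI : 0 <= h + t <= 1.
    suff : h + t \in `]0, 1[ by rewrite in_itv /= => /andP[/ltW-> /ltW->].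
    near: h; apply: (sh [set s : R | s \in `]0, 1[]).
    by apply: near_in_itvoo; rewrite in_itv.
  have hx0 : dot (x t) (x (h + t)) != 0.
    near: h; apply: (sh [set s | dot (x t) (x s) != 0]).
    exact: cvgr_neq0 (cdot _) _.
  have := eigenpath_diff (hx _ hI).2 xtE; rewrite addrK => e.
  rewrite /= [h *: 1]mulr1.
  have -> : lam (h + t) - lam t =
      h * (dot (coupling (x t)) (x (h + t)) / dot (x t) (x (h + t))).
    by apply: (mulIf hx0); rewrite e mulrA mulfVK.
  by rewrite -[RHS]/(_ * _) mulKf.
apply: DeriveDef; first exact: cvgP H.
exact: cvg_lim H.
Unshelve. all: by end_near.
Qed.

Lemma eigenpath_bound (x : R -> 'cV[R]_(k + m)) (lam : R -> R) (delta : R)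
    (deltaJ : 'I_k -> R) :
  {within `[0, 1], continuous x} -> {within `[0, 1], continuous lam} ->
  (forall t : R, 0 <= t <= 1 -> x t <> 0 /\ At t *m x t = lam t *: x t) ->
  0 <= delta ->
  (forall t j, 0 <= t <= 1 -> delta <= `|lam t - mu j|) ->
  (forall t p, 0 <= t <= 1 -> p \notin I -> 0 < deltaJ p <= `|lam t - theta 0 p|) ->
  0 < d_coef i l E delta deltaJ ->
  `|lam 1 - lam 0| <= d_coef i l E delta deltaJ * norm2 EI ^+ 2.
Proof.
move=> xc lc hx delta0 hd hJ; set d := d_coef _ _ _ _ _ => d0.
apply: derivative_linear_bound => // t t01; split.
  exact: eigenpath_derive xc hx t t01.
have tI : 0 <= t <= 1 by case/andP: t01 => /ltW-> /ltW->.
have [/eqP xt0 xtE] := hx t tI.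
have xx : 0 < dot (x t) (x t) by rewrite lt0r dot_eq0 xt0 dot_ge0.
rewrite normrM normfV (gtr0_norm xx) ler_pdivrMr //.
rewrite -[x t]vsubmxK in xtE *; move: (usubmx _) (dsubmx _) xtE => x1 x2 xtE.
rewrite /coupling col_mxKu col_mxKd !dot_col_mx.
have hne q : q \notin I -> theta 0 q != lam t.
  move=> /(hJ t _ tI) /andP[J0 Jl]; apply: contraTneq J0 => e; move: Jl.
  by rewrite e subrr normr0 leNgt.
have := schur_bound x2 delta0 (fun j => hd t j tI)
  (fun p => hJ t p tI) d0.
(* This gives |x2| <= d t |g|. The factor t makes the derivative bound integrate to eta. *)
rewrite (schur_eigenvector hne xtE) enormN enormZ -/d.
set g := E *m (clP *m x1); have t0 : 0 < t by case/andP: t01.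
rewrite (gtr0_norm t0) => x2g.
have -> : dot (clP *m (E^T *m x2)) x1 = dot g x2.
  by rewrite /g [LHS]dotC 2![RHS]dot_mulmxl clP_tr.
have gx : enorm g ^+ 2 <= norm2 EI ^+ 2 * (dot x1 x1 + dot x2 x2).
  apply: (@le_trans _ _ (norm2 EI ^+ 2 * enorm x1 ^+ 2)).
    rewrite -exprMn ler_sqr ?nnegrE ?mulr_ge0 ?enorm_ge0 ?norm2_ge0 //.
    apply: le_trans (enorm_clcols _) _.
    by rewrite ler_wpM2l ?norm2_ge0 // enorm_clP.
  by rewrite ler_wpM2l ?sqr_ge0 // enorm_sqr lerDl dot_ge0.
have : `|dot g x2| <= d * t * (norm2 EI ^+ 2 * (dot x1 x1 + dot x2 x2)).
  apply: le_trans (cauchy_schwarz _ _) _.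
  apply: (@le_trans _ _ (enorm g * (d * (t * enorm g)))).
    by rewrite ler_wpM2l ?enorm_ge0.
  rewrite (_ : _ * _ = d * t * enorm g ^+ 2); last by ring.
  by rewrite ler_wpM2l // mulr_ge0 ?ltW.
move=> h; apply: le_trans (ler_normD _ _) _; apply: le_trans (lerD h h) _.
by rewrite le_eqVlt; apply/orP; left; apply/eqP; ring.
Qed.
End Cluster.

(** * Specialization to the stated gaps *)

Theorem theorem2 (R : realType) (k m : nat) (hk : (0 < k)%N) (hm : (0 < m)%N)
  (theta : 'rV[R]_k) (E : 'M[R]_(m, k)) (A2 : 'M[R]_m)
  (A2sym : A2^T = A2)
  (mu : 'I_m -> R) (hmu : eigenvalues_of A2 mu)
  (i l : nat) (hl : (0 < l)%N) (hil : (i + l <= k)%N)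
  (lambda0 Delta : R) (hDelta : 0 <= Delta)
  (hint : forall p : 'I_k, p \in cluster_set k i l ->
     lambda0 - Delta <= theta 0 p <= lambda0 + Delta) :
  let EI := cluster_cols hil E in
  (let delta :=
     inf [set `|lambda0 - mu j| | j in [set: 'I_m]] - Delta - norm2 EI in
   let deltaJ := fun p : 'I_k => `|theta 0 p - lambda0| - Delta - norm2 EI in
   let d := d_coef i l E delta deltaJ in
   0 < delta ->
   (forall p : 'I_k, p \notin cluster_set k i l -> 0 < deltaJ p) ->
   0 < d ->
   exists lam : 'I_(k + m) -> R,
     eigenvalues_of (ritz_mx theta E A2) lam /\
     (forall p : 'I_k, p \in cluster_set k i l ->
        `|lam (lshift m p) - theta 0 p| <= d * norm2 EI ^+ 2))
  /\
  (forall (x : 'I_l -> R -> 'cV[R]_(k + m)) (lam : 'I_l -> R -> R),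
   (forall q : 'I_l, {within `[0, 1], continuous (x q)}) ->
   (forall q : 'I_l, {within `[0, 1], continuous (lam q)}) ->
   (forall (q : 'I_l) (t : R), 0 <= t <= 1 ->
      x q t <> 0 /\
      ritz_mx theta (scale_cluster i l t E) A2 *m x q t = lam q t *: x q t) ->
   (forall q : 'I_l, lam q 0 = theta 0 (cluster_idx hil q)) ->
   forall (delta : R) (deltaJ : 'I_k -> R),
   0 < delta ->
   delta <= inf [set r : R | exists (q : 'I_l) (j : 'I_m) (t : R),
                           0 <= t <= 1 /\ r = `|lam q t - mu j|] ->
   (forall p : 'I_k, p \notin cluster_set k i l ->
      0 < deltaJ p /\
      deltaJ p <= inf [set r : R | exists (q : 'I_l) (t : R),
                                 0 <= t <= 1 /\ r = `|lam q t - theta 0 p|]) ->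
   let d := d_coef i l E delta deltaJ in
   0 < d ->
   forall q : 'I_l,
     `|lam q 1 - theta 0 (cluster_idx hil q)| <= d * norm2 EI ^+ 2).
Proof.
move=> EI; split=> [delta deltaJ d delta0 J0 d0|].
  apply: (cluster_eigenvalues A2sym hmu (lambda0 := lambda0) (Delta := Delta)) d0.
  - by move=> p /hint; rewrite ler_distl.
  (* Moving from [lambda0] to [lam] costs at most Delta + |E_I|, exactly what [delta] and [deltaJ]
     subtract. *)
  - move=> lam hlam; split=> [j|p pI].
      have : inf [set `|lambda0 - mu j| | j in [set: 'I_m]] <= `|lambda0 - mu j|.
        by apply: ge_inf; [exists 0 => _ [? _ <-] | exists j].
      have := ler_distD lam lambda0 (mu j); rewrite (distrC lambda0 lam).
      by rewrite /delta /EI; move: hlam; lra.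
    rewrite J0 // /deltaJ /EI.
    have := ler_distD lam (theta 0 p) lambda0; rewrite (distrC (theta 0 p) lam).
    by move: hlam; lra.
  - exact: ltW.
move=> x lam xc lc hx lam0 delta deltaJ delta0 hd hJ d d0 q; rewrite -lam0.
apply: (eigenpath_bound A2sym hmu hil (xc q) (lc q) (hx q)) d0.
- exact: ltW.
(* The infimum bounds each member of the set from below because 0 is a lower bound of the set. *)
- move=> t j t01; apply: le_trans hd _; apply: ge_inf.
    by exists 0 => _ [? [? [? [_ ->]]]].
  by exists q, j, t.
move=> t p t01 /hJ[-> hp]; apply: le_trans hp _; apply: ge_inf.
  by exists 0 => _ [? [? [_ ->]]].
by exists q, t.
Qed.
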